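(* Let $1<a_1<a_2$ be integers with $\gcd(a_1,a_2)=1$. For a positive integer $m$, let $0\le r_m<a_1$ be the unique integer with $a_2r_m\equiv m\pmod{a_1}$. For a positive integer $n$ let $$f(n)=\#\{(x_1,x_2)\in\mathbb{Z}_{\ge0}^2:\ a_1x_1+a_2x_2=n,\ \gcd(x_1,x_2)=1\}.$$ Then $$f(n)=\frac{\varphi(n)}{a_1a_2}+E(n),\qquad E(n)=\sum_{d\mid n}\mu\!\left(\frac{n}{d}\right)\left(1-\frac{r_d}{a_1}-\left\{\frac{d-a_2r_d}{a_1a_2}\right\}\right),$$ and the error term satisfies $|E(n)|<2^{\omega(n)}$.
   Context: $\varphi$ is Euler's totient function, $\mu$ the Möbius function, $\omega(n)$ the number of distinct prime factors of $n$, and $\{t\}=t-\lfloor t\rfloor$ the fractional part of $t$. *)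

(* Defs.v *)
From mathcomp Require Import all_boot all_order all_algebra.
From mathcomp Require Import finmap.
From mathcomp Require Import boolp classical_sets cardinality.

Set Implicit Arguments.
Unset Strict Implicit.
Unset Printing Implicit Defensive.

Import Order.TTheory GRing.Theory Num.Theory.

Local Open Scope classical_set_scope.
Local Open Scope ring_scope.

Definition omega (n : nat) : nat := size (primes n).

(* Only meaningful for n > 0. *)
Definition mobius (n : nat) : int :=
  if all (fun p => logn p n <= 1)%N (primes n) then (-1) ^+ omega n else 0.

Definition fracpart (t : rat) : rat := t - (Num.floor t)%:~R.

Definition coprime_solutions (a1 a2 n : nat) : set (nat * nat) :=
  [set x | (a1 * x.1 + a2 * x.2)%N = n /\ gcdn x.1 x.2 = 1%N].

(* [fset_set] is the empty set on infinite sets; this default is never met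
   when a1, a2 > 0, see [coprime_solutions_finite]. *)
Definition num_coprime_solutions (a1 a2 n : nat) : nat :=
  #|` fset_set (coprime_solutions a1 a2 n)|%fset.

Definition error_term (a1 a2 : nat) (r : nat -> nat) (n : nat) : rat :=
  \sum_(d <- divisors n)
    (mobius (n %/ d))%:~R *
    (1 - (r d)%:R / a1%:R
       - fracpart ((d%:R - a2%:R * (r d)%:R) / (a1%:R * a2%:R))).

Lemma coprime_solutions_finite (a1 a2 n : nat) :
  (0 < a1)%N -> (0 < a2)%N -> finite_set (coprime_solutions a1 a2 n).
Proof.
move=> a1_gt0 a2_gt0.
apply: (@sub_finite_set _ _ (`I_n.+1 `*` `I_n.+1)); last first.
  by apply: finite_setX; exact: finite_II.
move=> [x y] [/= <- _]; split => /=; rewrite ltnS.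
  by rewrite (leq_trans (leq_pmull x a1_gt0))// leq_addr.
by rewrite (leq_trans (leq_pmull y a2_gt0))// leq_addl.
Qed.

Lemma residue_exists_unique (a1 a2 m : nat) :
  (0 < a1)%N -> coprime a1 a2 ->
  exists! r : nat, (r < a1)%N /\ (a2 * r = m %[mod a1])%N.
Proof.
move=> a1_gt0 co12.
have inj r s : (r < a1)%N -> (s < a1)%N ->
    (a2 * r = a2 * s %[mod a1])%N -> r = s.
  wlog le_sr : r s / (s <= r)%N => [hw|] ltr lts.
    case: (leqP s r) => [|/ltnW] h e; first exact: hw.
    by apply/esym/hw.
  move/eqP; rewrite eqn_mod_dvd ?leq_mul2l ?le_sr ?orbT// -mulnBr Gauss_dvdr//.
  rewrite /dvdn modn_small; last by rewrite (leq_ltn_trans (leq_subr _ _)).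
  by rewrite subn_eq0 => le_rs; apply/eqP; rewrite eqn_leq le_rs.
have [w hw] : exists w, (a2 * w = m %[mod a1])%N.
  have /dvdnP[w hw] : (a2 %| chinese a1 a2 m 0)%N.
    by rewrite /dvdn chinese_modr// mod0n.
  by exists w; rewrite mulnC -hw chinese_modl.
exists (w %% a1)%N; split; first by rewrite ltn_mod a1_gt0 modnMmr.
by move=> s [lts es]; apply: inj; rewrite ?ltn_mod// modnMmr es.
Qed.

(* Main.v *)
(* Let N(m) be the number of all solutions of a1 x1 + a2 x2 = m.  Sorting them
   by gcd(x1, x2) gives N(n) = sum_{d | n} f(d), so f is recovered from N by
   Mobius inversion.  In a solution x2 = r_m + a1 k with k ranging over
   0 <= k <= (m - a2 r_m) / (a1 a2), and this quotient is > -1, hence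
   N(m) = floor((m - a2 r_m) / (a1 a2)) + 1.  The linear part of N inverts to
   phi(n) / (a1 a2), what is left is E(n).  Its terms have weight in (-1, 1],
   and exactly 2 ^ omega(n) of them have a nonzero Mobius coefficient. *)
Require Import Defs.
From mathcomp Require Import all_boot all_order all_algebra cyclic.
From mathcomp Require Import finmap boolp classical_sets cardinality.
From mathcomp Require Import ring lra.

Set Implicit Arguments.
Unset Strict Implicit.
Unset Printing Implicit Defensive.

Import Order.TTheory GRing.Theory Num.Theory.

Local Open Scope ring_scope.

(** * Divisor lists and the involution d -> n / d *)

Lemma perm_divisors_dvd m n : (0 < n)%N -> (m %| n)%N ->
  perm_eq (divisors m) [seq d <- divisors n | d %| m]%N.
Proof.
move=> n_gt0 dvd_mn; have m_gt0 := dvdn_gt0 n_gt0 dvd_mn.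
apply: uniq_perm; rewrite ?filter_uniq ?divisors_uniq // => d.
rewrite mem_filter -!dvdn_divisors //.
by case dvd_dm: (d %| m)%N => //=; rewrite (dvdn_trans dvd_dm).
Qed.

Lemma divn_compl d n : (0 < n)%N -> (d %| n)%N -> (n %/ (n %/ d))%N = d.
Proof.
move=> n_gt0 /dvdnP[q def_n]; move: n_gt0.
by rewrite def_n muln_gt0 => /andP[q_gt0 d_gt0]; rewrite mulnK // mulKn.
Qed.

Lemma perm_divisors_compl n : (0 < n)%N ->
  perm_eq [seq n %/ d | d <- divisors n]%N (divisors n).
Proof.
move=> n_gt0; apply: uniq_perm; rewrite ?divisors_uniq //.
  rewrite map_inj_in_uniq ?divisors_uniq // => d e.
  rewrite -!dvdn_divisors // => /(divn_compl n_gt0) {2}<-.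
  by move=> /(divn_compl n_gt0) {2}<- ->.
move=> d; rewrite -dvdn_divisors //; apply/mapP/idP => [[e] | dvd_dn].
  by rewrite -dvdn_divisors // => dvd_en ->; rewrite dvdn_div.
by exists (n %/ d)%N; rewrite ?divn_compl // -dvdn_divisors // dvdn_div.
Qed.

(** * Splitting off a full prime power *)

Section PrimePowerFactor.

Variables (p k m : nat).
Hypotheses (p_pr : prime p) (m_gt0 : (0 < m)%N) (co_pm : coprime p m).

Lemma perm_primes_pfactor : perm_eq (primes (p ^ k.+1 * m)) (p :: primes m).
Proof.
have pk_gt0 : (0 < p ^ k.+1)%N by rewrite expn_gt0 prime_gt0.
apply: uniq_perm; rewrite /= ?primes_uniq //.
  by rewrite mem_primes p_pr m_gt0 -prime_coprime // co_pm.
by move=> q; rewrite primesM // primesX // primes_prime // !inE.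
Qed.

Lemma omega_pfactor : omega (p ^ k.+1 * m) = (omega m).+1.
Proof. by rewrite /omega (perm_size perm_primes_pfactor). Qed.

(** A divisor not divisible by p^2 has p-adic valuation 0 or 1, so it is d or p d for a unique d
    dividing m. Both sums over Mobius values below rest on this pairing. The vanishing is asked for
    positive d only, because [mobius 0] is 1. *)
Lemma sum_divisors_pfactor (V : nmodType) (F : nat -> V) :
    (forall d, (0 < d)%N -> (p ^ 2 %| d)%N -> F d = 0) ->
  \sum_(d <- divisors (p ^ k.+1 * m)) F d =
  \sum_(d <- divisors m) (F d + F (p * d)%N).
Proof.
move=> F0; have p_gt0 := prime_gt0 p_pr.
have n_gt0 : (0 < p ^ k.+1 * m)%N by rewrite muln_gt0 expn_gt0 p_gt0.
rewrite (bigID (fun d => p ^ 2 %| d)%N) /= big_seq_cond big1 ?add0r; last first.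
  move=> d /andP[]; rewrite -dvdn_divisors // => dn; apply: F0.
  exact: dvdn_gt0 dn.
rewrite big_split /= -(big_map (muln p) xpredT) -big_cat -big_filter /=.
have coprime_divm d : (d %| m)%N -> coprime p d.
  by move=> /coprime_dvdr; apply.
apply/perm_big/uniq_perm.
- by rewrite filter_uniq ?divisors_uniq.
- rewrite cat_uniq divisors_uniq map_inj_uniq ?divisors_uniq /=; last first.
    by move=> d e /eqP; rewrite eqn_pmul2l // => /eqP.
  rewrite andbT; apply/hasPn => _ /mapP[d _ ->].
  rewrite -dvdn_divisors //; apply/negP => /coprime_divm.
  by rewrite prime_coprime // dvdn_mulr.
move=> d; rewrite mem_filter mem_cat -!dvdn_divisors //.
apply/andP/orP => [[p2d dn] | [dm | /mapP[e]]].
(* If p divides d = e p, then p cannot divide e, since p^2 does not divide d; hence e is coprime to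
   p^(k+1) and divides m. *)
- have [/dvdnP[e def_d]|p'd] := boolP (p %| d)%N; last first.
    left; rewrite -(Gauss_dvdr _ (n := p ^ k.+1)) //.
    by rewrite coprime_sym coprimeXl ?prime_coprime.
  right; apply/mapP; exists e; last by rewrite mulnC.
  rewrite -dvdn_divisors // -(Gauss_dvdr _ (n := p ^ k.+1)).
    by apply: dvdn_trans dn; rewrite def_d dvdn_mulr.
  rewrite coprime_sym coprimeXl ?prime_coprime //.
  by apply: contra p2d => pe; rewrite def_d expnSr dvdn_mul.
- split; last by rewrite dvdn_mull.
  apply/negP=> /(dvdn_trans (dvdn_exp2l p (isT : 1 <= 2)%N)).
  by apply/negP; rewrite expn1 -prime_coprime // coprime_divm.
rewrite -dvdn_divisors // => em ->; split.
  by rewrite expnS expn1 dvdn_pmul2l // -prime_coprime // coprime_divm.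
by rewrite dvdn_mul // -{1}(expn1 p) dvdn_exp2l.
Qed.

End PrimePowerFactor.

(** * Sums of the Mobius function over divisors *)

Lemma mobius_primeM p d : prime p -> (0 < d)%N -> coprime p d ->
  mobius (p * d) = - mobius d.
Proof.
move=> p_pr d_gt0 co_pd; have p_gt0 := prime_gt0 p_pr.
have perm_pd : perm_eq (primes (p * d)) (p :: primes d).
  by rewrite -{1}(expn1 p) perm_primes_pfactor.
rewrite /mobius /omega (perm_all _ perm_pd) (perm_size perm_pd) /=.
rewrite lognM // logn_prime // eqxx lognE p_pr d_gt0 /=.
rewrite -[(p %| d)%N]negbK -prime_coprime // co_pd /=.
rewrite (@eq_in_all _ _ (fun q => logn q d <= 1)%N); last first.
  move=> q; rewrite mem_primes => /and3P[q_pr _ dvd_qd].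
  rewrite lognM // logn_prime //; case: eqP => // def_q.
  by move: co_pd; rewrite prime_coprime // -def_q dvd_qd.
by case: ifP; rewrite ?oppr0 // exprS mulN1r.
Qed.

Lemma mobius_sqr_dvd p d : prime p -> (0 < d)%N -> (p ^ 2 %| d)%N ->
  mobius d = 0.
Proof.
move=> p_pr d_gt0 p2d; rewrite /mobius; case: allP => // /(_ p).
rewrite mem_primes p_pr d_gt0 (dvdn_trans _ p2d) ?dvdn_exp // => /(_ isT).
by rewrite leqNgt -pfactor_dvdn // p2d.
Qed.

Lemma mobius1 : mobius 1 = 1. Proof. by []. Qed.

Lemma mobius_prime p : prime p -> mobius p = -1.
Proof. by move=> p_pr; rewrite -[p]muln1 mobius_primeM ?coprimen1. Qed.

Lemma pfactor_exists n : (1 < n)%N ->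
  exists p k m, [/\ prime p, (0 < m)%N, coprime p m & n = p ^ k.+1 * m]%N.
Proof.
move=> n_gt1; have n_gt0 := ltnW n_gt1.
have p_pr := pdiv_prime n_gt1.
have [m co_pm def_n] := pfactor_coprime p_pr n_gt0.
exists (pdiv n), (logn (pdiv n) n).-1, m; split=> //.
  by move: n_gt0; rewrite def_n muln_gt0 => /andP[].
by rewrite prednK ?logn_gt0 ?pi_pdiv // mulnC.
Qed.

(** For n > 1, the terms at d and p d cancel. *)
Lemma sum_mobius n : (0 < n)%N ->
  \sum_(d <- divisors n) mobius d = (n == 1)%N%:R.
Proof.
case: (ltngtP n 1) => [|n_gt1 _|-> _]; [by case: n | | by rewrite big_seq1].
have [p [k [m [p_pr m_gt0 co_pm ->]]]] := pfactor_exists n_gt1.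
rewrite sum_divisors_pfactor //; last by move=> d; apply: mobius_sqr_dvd.
rewrite big_seq big1 // => d; rewrite -dvdn_divisors // => dvd_dm.
by rewrite mobius_primeM ?subrr ?(dvdn_gt0 _ dvd_dm) // (coprime_dvdr dvd_dm).
Qed.

(** The terms at d and p d have equal absolute value, so each prime of n doubles the sum. *)
Lemma sum_norm_mobius n : (0 < n)%N ->
  \sum_(d <- divisors n) `|mobius d| = 2 ^+ omega n.
Proof.
elim/ltn_ind: n => n IHn n_gt0.
have [n_gt1|] := ltnP 1 n; last first.
  by case: n n_gt0 {IHn} => [|[|]] // _ _; rewrite big_seq1.
have [p [k [m [p_pr m_gt0 co_pm def_n]]]] := pfactor_exists n_gt1.
rewrite def_n sum_divisors_pfactor // => [|d d_gt0 /mobius_sqr_dvd->] //.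
rewrite omega_pfactor // exprS -IHn //; last first.
  by rewrite def_n ltn_Pmull // -{1}(expn0 p) ltn_exp2l ?prime_gt1.
rewrite mulr_sumr; apply: eq_big_seq => d; rewrite -dvdn_divisors // => dvd_dm.
rewrite mobius_primeM ?(dvdn_gt0 _ dvd_dm) ?(coprime_dvdr dvd_dm) //.
by rewrite normrN mulr2n mulrDl mul1r.
Qed.

(** * Mobius inversion and the totient *)

Lemma mobius_inversion (R : pzRingType) (f g : nat -> R) n : (0 < n)%N ->
    (forall m, (m %| n)%N -> g m = \sum_(d <- divisors m) f d) ->
  f n = \sum_(d <- divisors n) (mobius (n %/ d))%:~R * g d.
Proof.
move=> n_gt0 def_g.
transitivity (\sum_(e <- divisors n) \sum_(d <- divisors n | (d %| n %/ e)%N)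
                (mobius d)%:~R * f e).
  (* The inner sum of Mobius values over the divisors of n / e is 1 when e = n and 0 otherwise. *)
  rewrite [RHS](eq_big_seq (fun e => (e == n)%:R * f e)).
    rewrite (bigD1_seq n) ?divisors_uniq -?dvdn_divisors //= eqxx mul1r.
    by rewrite big1 ?addr0 // => e /negPf->; rewrite mul0r.
  move=> e; rewrite -dvdn_divisors // => dvd_en.
  have q_gt0 := dvdn_gt0 n_gt0 (dvdn_div dvd_en).
  rewrite -big_filter -(perm_big _ (perm_divisors_dvd n_gt0 (dvdn_div dvd_en))).
  rewrite -mulr_suml; congr (_ * _).
  transitivity ((\sum_(d <- divisors (n %/ e)) mobius d)%:~R : R).
    by rewrite rmorph_sum.
  rewrite sum_mobius // rmorph_nat eq_sym eqn_div ?mul1n //.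
  exact: dvdn_gt0 dvd_en.
(* After the exchange, d divides n / e exactly when e divides n / d, so the inner sum is g(n /
   d). *)
rewrite (exchange_big_dep xpredT) //=.
rewrite -[RHS](perm_big _ (perm_divisors_compl n_gt0)) big_map.
apply: eq_big_seq => d; rewrite -dvdn_divisors // => dvd_dn.
rewrite divn_compl // def_g ?dvdn_div // mulr_sumr.
rewrite (perm_big _ (perm_divisors_dvd n_gt0 (dvdn_div dvd_dn))) big_filter.
rewrite [LHS]big_seq_cond [RHS]big_seq_cond; apply: eq_bigl => e.
case: (boolP (e \in _)) => //=; rewrite -dvdn_divisors // => dvd_en.
by rewrite !dvdn_divRL // mulnC.
Qed.

(** Inversion of Gauss's identity: the totients of the divisors of m sum to m. *)
Lemma totient_mobius (R : pzRingType) n : (0 < n)%N ->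
  (totient n)%:R = \sum_(d <- divisors n) (mobius (n %/ d))%:~R * d%:R :> R.
Proof.
move=> n_gt0; apply: (@mobius_inversion R (fun d => (totient d)%:R) (fun d => d%:R)) => //.
move=> m dvd_mn; have m_gt0 := dvdn_gt0 n_gt0 dvd_mn.
rewrite -{1}(sum_totient_dvd m) natr_sum.
rewrite -(big_mkord (fun d => d %| m)%N (fun d => (totient d)%:R)).
rewrite -big_filter; apply/perm_big/uniq_perm.
- by rewrite filter_uniq ?iota_uniq.
- exact: divisors_uniq.
move=> d; rewrite mem_filter mem_index_iota -dvdn_divisors // ltnS andbC.
by case dvd_dm: (d %| m)%N; rewrite ?andbF //= andbT dvdn_leq.
Qed.

(** * Counting the nonnegative solutions *)

Section Solutions.

Variables a1 a2 : nat.
Hypotheses (a1_gt0 : (0 < a1)%N) (a2_gt0 : (0 < a2)%N).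

(** The box of side n + 1 loses nothing: positive coefficients force both coordinates to be at most
    n. An explicit list lets counts be compared through [perm_eq]. *)
Definition solutions n : seq (nat * nat) :=
  [seq x <- [seq (x1, x2) | x1 <- iota 0 n.+1, x2 <- iota 0 n.+1]
     | a1 * x.1 + a2 * x.2 == n]%N.

Lemma solutions_uniq n : uniq (solutions n).
Proof.
rewrite filter_uniq // allpairs_uniq ?iota_uniq //.
by move=> [? ?] [? ?] _ _ /= [-> ->].
Qed.

Lemma mem_solutions n x :
  (x \in solutions n) = (a1 * x.1 + a2 * x.2 == n)%N.
Proof.
rewrite mem_filter andb_idr // => /eqP def_n; apply/allpairsP; exists x.
rewrite !mem_iota /= !add0n !ltnS; split; last by case: x {def_n}.
  by rewrite -def_n (leq_trans (leq_pmull x.1 a1_gt0)) ?leq_addr.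
by rewrite -def_n (leq_trans (leq_pmull x.2 a2_gt0)) ?leq_addl.
Qed.

Lemma num_coprime_solutionsE n :
  num_coprime_solutions a1 a2 n =
  count (fun x => coprime x.1 x.2) (solutions n).
Proof.
rewrite -size_filter -[X in _ = size X]undup_id; last first.
  by rewrite filter_uniq ?solutions_uniq.
rewrite -card_fseq /num_coprime_solutions; congr #|` _|%fset.
apply/fsetP=> x; rewrite in_fset_set; last exact: coprime_solutions_finite.
rewrite !inE mem_filter mem_solutions /coprime; apply/asboolP/andP.
  by case=> /eqP ? /eqP.
by case=> /eqP ? /eqP.
Qed.

(** Scaling by d is a bijection from the coprime solutions for n / d onto the solutions for n with
    gcd d. *)
Lemma count_gcd_solutions n d : (0 < n)%N -> (d %| n)%N ->
  count (fun x => gcdn x.1 x.2 == d) (solutions n) =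
  num_coprime_solutions a1 a2 (n %/ d).
Proof.
move=> n_gt0 dvd_dn; have d_gt0 := dvdn_gt0 n_gt0 dvd_dn.
rewrite num_coprime_solutionsE -!size_filter.
rewrite -[RHS](size_map (fun x => (d * x.1, d * x.2)%N)).
have scale_inj : injective (fun x : nat * nat => (d * x.1, d * x.2)%N).
  move=> [x1 x2] [y1 y2] /= [/eqP + /eqP].
  by rewrite !eqn_pmul2l // => /eqP-> /eqP->.
apply/perm_size/uniq_perm.
- by rewrite filter_uniq ?solutions_uniq.
- by rewrite map_inj_uniq // filter_uniq ?solutions_uniq.
move=> x; rewrite mem_filter mem_solutions; apply/andP/mapP.
  case=> /eqP gcd_x /eqP def_n.
  have [dvd1 dvd2] : (d %| x.1)%N /\ (d %| x.2)%N.
    by rewrite -gcd_x dvdn_gcdl dvdn_gcdr.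
  exists (x.1 %/ d, x.2 %/ d)%N; last first.
    by rewrite /= !(mulnC d) !divnK //; case: (x).
  rewrite mem_filter mem_solutions /= /coprime.
  rewrite -(eqn_pmul2l d_gt0) muln_gcdr !(mulnC d) !divnK // mul1n gcd_x eqxx.
  rewrite -(eqn_pmul2r d_gt0) mulnDl -!mulnA !divnK //; exact/eqP.
case=> y; rewrite mem_filter mem_solutions => /andP[co_y /eqP def_q] -> /=.
rewrite -muln_gcdr (eqP co_y) muln1 eqxx; split=> //.
by rewrite !(mulnCA _ d) -mulnDr def_q mulnC divnK.
Qed.

Lemma size_solutions_sum n : (0 < n)%N ->
  size (solutions n) =
  (\sum_(d <- divisors n) num_coprime_solutions a1 a2 d)%N.
Proof.
move=> n_gt0; rewrite -(perm_big _ (perm_divisors_compl n_gt0)) big_map.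
transitivity (\sum_(x <- solutions n)
                \sum_(d <- divisors n | gcdn x.1 x.2 == d) 1)%N.
  rewrite -sum1_size; apply: eq_big_seq => x.
  rewrite mem_solutions => /eqP def_n.
  rewrite sum1_count (eq_count (a2 := pred1 (gcdn x.1 x.2))) => [|d]; last first.
    exact: eq_sym.
  rewrite count_uniq_mem ?divisors_uniq // -dvdn_divisors //.
  by rewrite -def_n dvdn_add // dvdn_mull ?dvdn_gcdl ?dvdn_gcdr.
rewrite (exchange_big_dep xpredT) //=; apply: eq_big_seq => d.
by rewrite -dvdn_divisors // => dvd_dn; rewrite sum1_count count_gcd_solutions.
Qed.

(** A solution is determined by x2, and the values of x2 form the progression s + a1 k with k <
    K. *)
Lemma size_solutions n s : coprime a1 a2 -> (s < a1)%N ->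
    (a2 * s = n %[mod a1])%N ->
  size (solutions n) =
  (if a2 * s <= n then ((n - a2 * s) %/ (a1 * a2)).+1 else 0)%N.
Proof.
move=> co_a lt_s mod_s; set K := (if _ then _ else _).
rewrite -[LHS](size_map snd) -[K](size_iota 0).
rewrite -[RHS](size_map (fun k => s + a1 * k)%N).
(* K counts the k that leave a nonnegative remainder for a1 x1; there are none once a2 s exceeds
   n. *)
have lt_K k : (k < K)%N = (a2 * (s + a1 * k) <= n)%N.
  rewrite /K mulnDr; case: (leqP (a2 * s) n) => [le_s | gt_s].
    rewrite ltnS leq_divRL ?muln_gt0 ?a1_gt0 // leq_subRL //.
    by congr (_ + _ <= _)%N; ring.
  by rewrite ltn0; apply/esym/negbTE; rewrite -ltnNge (leq_trans gt_s) ?leq_addr.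
apply/perm_size/uniq_perm.
- have snd_inj : {in solutions n &, injective snd}.
    move=> [x1 x2] [y1 y2]; rewrite !mem_solutions /= => /eqP <- /[swap] <-.
    by rewrite eqn_add2r eqn_pmul2l // => /eqP->.
  by rewrite (map_inj_in_uniq snd_inj) solutions_uniq.
- rewrite map_inj_uniq ?iota_uniq // => i j /eqP.
  by rewrite eqn_add2l eqn_pmul2l // => /eqP.
move=> y; apply/mapP/mapP => [[[x1 x2]] | [k]].
  rewrite mem_solutions /= => /eqP def_n ->.
  have [t [_ t_uniq]] := residue_exists_unique n a1_gt0 co_a.
  (* Modulo a1 the equation becomes a2 x2 = n, which has a single residue as solution. *)
  have mod_x2 : (x2 %% a1 = s)%N.
    rewrite -[RHS]t_uniq //; apply/esym/t_uniq; rewrite ltn_mod; split=> //.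
    by rewrite modnMmr -def_n [(a1 * x1)%N]mulnC modnMDl.
  have def_x2 : x2 = (s + a1 * (x2 %/ a1))%N.
    by rewrite {1}(divn_eq x2 a1) mod_x2 addnC mulnC.
  exists (x2 %/ a1)%N => //.
  by rewrite mem_iota add0n lt_K -def_x2 -def_n leq_addl.
(* Conversely x1 is (n - a2 x2) / a1, an exact quotient by the congruence on s. *)
rewrite mem_iota add0n lt_K => /= le_n ->.
exists (((n - a2 * (s + a1 * k)) %/ a1)%N, (s + a1 * k)%N) => //.
rewrite mem_solutions /= mulnC divnK ?subnK // -eqn_mod_dvd //.
by rewrite mulnDr mulnCA addnC [(a1 * _)%N]mulnC modnMDl mod_s.
Qed.

End Solutions.

(** * The number of solutions through the fractional part *)

Lemma fracpart_itv t : 0 <= fracpart t < 1.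
Proof.
by have := floor_itv t; rewrite /fracpart intrD => /andP[? ?]; apply/andP; lra.
Qed.

(** Both cases of [size_solutions] equal the floor of the quotient plus one; replacing the floor by
    the quotient minus its fractional part gives the formula. *)
Lemma size_solutions_fracpart a1 a2 n s : (0 < a1)%N -> (0 < a2)%N ->
    coprime a1 a2 -> (s < a1)%N -> (a2 * s = n %[mod a1])%N ->
  (size (solutions a1 a2 n))%:R =
  n%:R / (a1%:R * a2%:R) +
  (1 - s%:R / a1%:R - fracpart ((n%:R - a2%:R * s%:R) / (a1%:R * a2%:R))) :> rat.
Proof.
move=> a1_gt0 a2_gt0 co_a lt_s mod_s.
have a1_neq0 : a1%:R != 0 :> rat by rewrite pnatr_eq0 -lt0n.
have a2_neq0 : a2%:R != 0 :> rat by rewrite pnatr_eq0 -lt0n.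
have a_gt0 : 0 < a1%:R * a2%:R :> rat by rewrite -natrM ltr0n muln_gt0 a1_gt0.
suff floorE : (size (solutions a1 a2 n))%:Z =
    Num.floor ((n%:R - a2%:R * s%:R) / (a1%:R * a2%:R) : rat) + 1.
  rewrite pmulrn floorE intrD /fracpart; field.
  by rewrite a1_neq0 a2_neq0.
rewrite (size_solutions a1_gt0 a2_gt0 co_a lt_s mod_s).
case: (leqP (a2 * s) n) => [le_s | gt_s].
  rewrite (@floor_def _ _ ((n - a2 * s) %/ (a1 * a2))%N%:Z).
    by rewrite intS addrC.
  rewrite ler_pdivlMr // ltr_pdivrMr // -!natrM -natrB //.
  rewrite ler_nat ltr_nat addn1.
  by rewrite leq_trunc_div ltn_ceil // muln_gt0 a1_gt0.
(* Since s < a1, the negative quotient is at least -1; its floor is -1, which matches the count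
   0. *)
rewrite (@floor_def _ _ (-1)) ?addNr // ler_pdivlMr // ltr_pdivrMr //.
rewrite mul0r subr_lt0 mulN1r -!natrM ltr_nat gt_s andbT.
have : (a2 * s)%:R <= n%:R + (a1 * a2)%:R :> rat.
  rewrite -natrD ler_nat (leq_trans _ (leq_addl _ _)) //.
  by rewrite mulnC leq_mul2r ltnW ?orbT.
lra.
Qed.

(** * The strict bound on Mobius sums *)

Lemma ltr_sum_seq (R : numDomainType) (I : eqType) (s : seq I) (F G : I -> R) j :
  uniq s -> j \in s -> F j < G j -> {in s, forall i, F i <= G i} ->
  \sum_(i <- s) F i < \sum_(i <- s) G i.
Proof.
move=> s_uniq js lt_j le_s; rewrite !(bigD1_seq j) //= ltr_leD //.
by rewrite big_seq_cond [leRHS]big_seq_cond ler_sum // => i /andP[/le_s].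
Qed.

(* Strictness comes from the divisor d = n (mobius value 1) in the lower bound
   and from d = n / p (mobius value -1) in the upper one. *)
Lemma norm_mobius_sum_lt (R : realDomainType) (g : nat -> R) n : (0 < n)%N ->
    (forall d, (d %| n)%N -> -1 < g d <= 1) -> (n = 1%N -> g 1%N < 1) ->
  `|\sum_(d <- divisors n) (mobius (n %/ d))%:~R * g d| < 2 ^+ omega n.
Proof.
move=> n_gt0 g_itv g1; rewrite -(perm_big _ (perm_divisors_compl n_gt0)) big_map.
rewrite (eq_big_seq (fun d => (mobius d)%:~R * g (n %/ d)%N)) => [|d]; last first.
  by rewrite -dvdn_divisors // => dvd_dn; rewrite divn_compl.
(* Writing the bound as a sum of absolute values allows a termwise comparison. *)
have -> : 2 ^+ omega n = \sum_(d <- divisors n) `|(mobius d)%:~R| :> R.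
  under eq_bigr do rewrite -intr_norm.
  by rewrite -rmorph_sum sum_norm_mobius // rmorphXn.
have term_le d : d \in divisors n ->
    `|(mobius d)%:~R * g (n %/ d)%N| <= `|(mobius d)%:~R|.
  rewrite -dvdn_divisors // => dvd_dn; rewrite normrM ler_piMr //.
  have /andP[/ltW ? ?] := g_itv _ (dvdn_div dvd_dn).
  by rewrite ler_norml; apply/andP.
rewrite ltr_norml -sumrN; apply/andP; split.
  apply: (@ltr_sum_seq _ _ _ _ _ 1%N); rewrite ?divisors_uniq -?dvdn_divisors //.
    by rewrite mobius1 normr1 mul1r divn1; case/andP: (g_itv n (dvdnn n)).
  by move=> d /term_le; rewrite ler_norml => /andP[].
(* For n = 1 there is no prime p to use, so strictness comes from the assumption on g(1). *)
have [n_gt1 | n_le1] := ltnP 1 n; last first.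
  have def_n : n = 1%N by apply/eqP; rewrite eqn_leq n_le1.
  by rewrite def_n !big_seq1 mobius1 normr1 mul1r g1.
apply: (@ltr_sum_seq _ _ _ _ _ (pdiv n)).
- exact: divisors_uniq.
- by rewrite -dvdn_divisors // pdiv_dvd.
- rewrite mobius_prime ?pdiv_prime // mulrN1z normrN1 mulN1r ltrNl.
  by case/andP: (g_itv _ (dvdn_div (pdiv_dvd n))).
by move=> d /term_le; rewrite ler_norml => /andP[].
Qed.

(** * The formula for f and the error bound *)

Theorem theorem2 (a1 a2 : nat) (r : nat -> nat)
  (ha1 : (1 < a1)%N) (ha12 : (a1 < a2)%N) (hgcd : gcdn a1 a2 = 1%N)
  (hr : forall m : nat, (0 < m)%N ->
          (r m < a1)%N /\ (a2 * r m = m %[mod a1])%N) :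
  forall n : nat, (0 < n)%N ->
    (num_coprime_solutions a1 a2 n)%:R =
      (totient n)%:R / (a1%:R * a2%:R) + error_term a1 a2 r n
    /\ `|error_term a1 a2 r n| < 2 ^+ omega n.
Proof.
move=> n n_gt0; have a1_gt0 := ltnW ha1; have a2_gt0 := ltn_trans a1_gt0 ha12.
have co_a : coprime a1 a2 by apply/eqP.
have a1Q_gt0 : 0 < a1%:R :> rat by rewrite ltr0n.
split.
  rewrite (@mobius_inversion rat (fun d => (num_coprime_solutions a1 a2 d)%:R)
             (fun d => (size (solutions a1 a2 d))%:R) n n_gt0); last first.
    move=> m dvd_mn; rewrite -natr_sum -size_solutions_sum //.
    exact: dvdn_gt0 dvd_mn.
  rewrite totient_mobius // mulr_suml /error_term -big_split.
  apply: eq_big_seq => d; rewrite -dvdn_divisors // => dvd_dn.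
  have [lt_r mod_r] := hr _ (dvdn_gt0 n_gt0 dvd_dn).
  rewrite (size_solutions_fracpart a1_gt0 a2_gt0 co_a lt_r mod_r).
  by rewrite mulrDr mulrA.
rewrite /error_term; pose g d : rat := 1 - (r d)%:R / a1%:R
  - fracpart ((d%:R - a2%:R * (r d)%:R) / (a1%:R * a2%:R)).
(* The weight is 1 minus two numbers of [0, 1), hence lies in (-1, 1]. *)
apply: (@norm_mobius_sum_lt _ g) => // [d dvd_dn | _]; rewrite /g.
  have [lt_r _] := hr _ (dvdn_gt0 n_gt0 dvd_dn).
  have /andP[frac_ge0 frac_lt1] :=
    fracpart_itv ((d%:R - a2%:R * (r d)%:R) / (a1%:R * a2%:R)).
  have ratio_ge0 : 0 <= (r d)%:R / a1%:R :> rat by rewrite divr_ge0 ?ler0n.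
  have ratio_lt1 : (r d)%:R / a1%:R < 1 :> rat.
    by rewrite ltr_pdivrMr // mul1r ltr_nat.
  by apply/andP; lra.
(* At d = 1 the weight is below 1: as a1 > 1, the congruence a2 r_1 = 1 modulo a1 excludes r_1 =
   0. *)
have [_ mod_r] := hr _ (ltn0Sn 0).
have /andP[frac_ge0 _] :=
  fracpart_itv ((1%:R - a2%:R * (r 1%N)%:R) / (a1%:R * a2%:R)).
have ratio_gt0 : 0 < (r 1%N)%:R / a1%:R :> rat.
  rewrite divr_gt0 // ltr0n lt0n; apply/eqP => r0.
  by move: mod_r; rewrite r0 muln0 mod0n modn_small.
lra.
Qed.
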